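(* Let $s:[1,\infty)\to\mathbb{R}$ be Lebesgue integrable on every bounded interval $(1,t)$, $t>1$, and let $$\tau(t):=\frac{1}{\log t}\int_1^t\frac{s(x)}{x}\,dx,\qquad t>1.$$ Suppose that $s$ is slowly decreasing with respect to summability $(L,1)$. If $\tau$ has statistical limit $\ell$ at $\infty$ for some number $\ell$, then the ordinary limit $\lim_{x\to\infty}s(x)$ exists and equals $\ell$.
   Context: The logarithm is to the natural base $e$, and $|\{\cdot\}|$ denotes Lebesgue measure. Statistical limit: a (real- or complex-valued) measurable function $g$ on an interval $(a,\infty)$, $a\ge 0$, has statistical limit $\ell$ (a finite number) at $\infty$ if for every $\varepsilon>0$, $$\lim_{b\to\infty}\frac{1}{b-a}\Big|\{x\in(a,b):|g(x)-\ell|>\varepsilon\}\Big|=0.$$ The choice of the left endpoint $a$ is immaterial; for $\tau$ one may take $a=1$. Slow decrease: a function $s:[1,\infty)\to\mathbb{R}$ is slowly decreasing with respect to summability $(L,1)$ (logarithmic summability) if $$\lim_{\lambda\to1^+}\ \liminf_{x\to\infty}\ \inf_{x<t\le x^\lambda}\big(s(t)-s(x)\big)\ge 0.$$ Equivalently: for every $\varepsilon>0$ there exist $x_0=x_0(\varepsilon)>1$ and $\lambda=\lambda(\varepsilon)>1$ such that $s(t)-s(x)\ge-\varepsilon$ whenever $x_0\le x<t\le x^\lambda$. *)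

(* Defs.v *)
From HB Require Import structures.
From mathcomp Require Import all_boot all_order all_algebra.
From mathcomp Require Import all_classical all_reals all_analysis.
Import Order.TTheory GRing.Theory Num.Theory.
Import numFieldNormedType.Exports.

Set Implicit Arguments.
Unset Strict Implicit.
Unset Printing Implicit Defensive.

Local Open Scope classical_set_scope.
Local Open Scope ring_scope.

(** MathComp-Analysis.  [lebesgue_measure] is the restriction of Lebesgue
    measure to the Borel sets; measurability and integrability in the sense of
    Lebesgue are those of its completion [completed_lebesgue_measure], which
    lives on the following type (the real line with the Lebesgue
    sigma-algebra). *)
Definition lebesgueTypeR (R : realType) : measurableType _ :=
  caratheodory_type ((wlength (R := R) idfun)^*)%mu.

Local Notation leb R := (@completed_lebesgue_measure R) (only parsing).

Definition is_statistical_limit (R : realType) (a : R) (g : R -> R) (l : R) :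
    Prop :=
  @measurable_fun _ _ (lebesgueTypeR R) (measurableTypeR R) `]a, +oo[ g /\
  forall e : R, 0 < e ->
    (((b - a)^-1)%:E * leb R [set x | (a < x < b)%R /\ (e < `|g x - l|)%R])%E
      @[b --> +oo] --> 0%E.

Definition log_mean (R : realType) (s : R -> R) (t : R) : R :=
  (ln t)^-1 * \int[leb R]_(x in `[1, t]) (s x / x).

(** The infimum, the limit inferior and the limit are taken in the extended
    reals, where the limit as lambda -> 1+ always exists by monotonicity. *)
Definition slowly_decreasing_log (R : realType) (s : R -> R) : Prop :=
  exists2 m : \bar R,
    limf_einf (fun x : R =>
        ereal_inf [set (s t - s x)%:E | t in `]x, x `^ lambda]]) +oo
      @[lambda --> (1 : R)^'+] --> m
    & (0 <= m)%E.

(* Main.v *)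
Require Import Defs.
From mathcomp Require Import all_boot all_order all_algebra.
From mathcomp Require Import all_classical all_reals all_analysis.
From mathcomp Require Import measurable_realfun ring lra.
Import Order.TTheory GRing.Theory Num.Theory.
Import numFieldNormedType.Exports.

(** The statistical limit of [log_mean s] passes directly to an ordinary limit
    of [s], without an intermediate limit of [log_mean s].

    The exceptional set where [log_mean s] is far from [l] has density zero, so
    every interval ]y, 2 y[ with [y] large contains a point outside it
    ([statistical_limit_near]).  On the scale [u = ln x] such points are at
    bounded distance from any given place, which is negligible compared with
    the length [(lambda - 1) * ln p] of the block ]p, p ^ lambda[.  Hence the
    block contains good points [a < b] whose logarithmic distance is comparable
    to [ln a + ln b].  As [ln b * log_mean s b - ln a * log_mean s a] is the
    integral of [s x / x] over ]a, b] ([log_mean_increment]), the mean of [s]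
    over ]a, b] with respect to dx / x is close to [l]
    ([statistical_limit_log_block]).

    Slow decrease compares this mean with one value of [s].  In the block
    ]x, x ^ lambda[, which follows [x], [s] is almost at least [s x], so [s x]
    is at most [l] up to a small error; in the block ]x ^ (1 / lambda), x[,
    which precedes [x], [s] is almost at most [s x], so [s x] is at least [l]
    up to a small error. *)

Local Open Scope classical_set_scope.
Local Open Scope ring_scope.

Local Notation leb R := (@completed_lebesgue_measure R) (only parsing).

(** * Integration against completed Lebesgue measure *)

Lemma borel_lebesgue_measurable (R : realType) (A : set (measurableTypeR R)) :
  measurable A -> @measurable _ (lebesgueTypeR R) A.
Proof. exact: sub_caratheodory. Qed.

Lemma lebesgue_measurable_itv (R : realType) (i : interval R) :
  @measurable _ (lebesgueTypeR R) [set` i].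
Proof. by apply: borel_lebesgue_measurable; exact: measurable_itv. Qed.

(** Lebesgue measure on the Borel sets is the image of its completion under
    the identity map, so both integrate a nonnegative Borel function alike. *)
Lemma ge0_integral_completed_lebesgue (R : realType) (A : set R)
    (f : R -> \bar R) :
  measurable A -> measurable_fun A f ->
  (forall x, A x -> (0 <= f x)%E) ->
  (\int[leb R]_(x in A) f x = \int[lebesgue_measure]_(x in A) f x)%E.
Proof.
move=> mA mf f0.
pose phi : lebesgueTypeR R -> measurableTypeR R := idfun.
have mphi : measurable_fun setT phi.
  by move=> _ B mB; rewrite setTI; exact: borel_lebesgue_measurable.
have := @ge0_integral_pushforward _ _ _ _ R phi mphi (leb R) A f mA mf.
move=> <- //.
by move=> x /set_mem; exact: f0.
Qed.

Lemma Rintegral_inv_ln (R : realType) (a b : R) : 0 < a -> a < b ->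
  \int[leb R]_(x in `]a, b]) x^-1 = ln b - ln a.
Proof.
move=> a0 ab.
have cV : {within `[a, b], continuous (fun x : R => x^-1)}.
  apply: continuous_in_subspaceT => x /set_mem; rewrite /= in_itv/= => /andP[ax _].
  by apply: inv_continuous; rewrite gt_eqF// (lt_le_trans a0).
have mV : measurable_fun (`]a, b] : set R) (fun x : R => (x^-1)%:E).
  apply/measurable_EFinP.
  apply: (@measurable_funS _ _ _ _ `[a, b]) => //.
    by apply: subset_itvr; rewrite bnd_simp.
  exact: subspace_continuous_measurable_fun.
rewrite /Rintegral ge0_integral_completed_lebesgue//; last first.
  move=> x /=; rewrite in_itv/= => /andP[ax _].
  by rewrite lee_fin invr_ge0 ltW// (lt_trans a0).
rewrite integral_itv_obnd_cbnd; last exact: mV.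
rewrite (@continuous_FTC2 _ (fun x => x^-1) (@ln R))//.
- split.
  + move=> x; rewrite in_itv/= => /andP[ax _].
    by apply: ex_derive; apply: is_derive1_ln; exact: lt_trans ax.
  + by apply: cvg_at_right_filter; exact: continuous_ln.
  + by apply: cvg_at_left_filter; apply: continuous_ln; exact: lt_trans ab.
- move=> x; rewrite in_itv/= => /andP[ax _].
  by rewrite derive1E; have [_ ->] := is_derive1_ln (lt_trans a0 ax).
Qed.

(** * Increments of the logarithmic mean *)

(** The integrals defining [log_mean] converge: on [1, b] the factor 1 / x is
    bounded by 1, and adding the endpoint 1 changes nothing. *)
Lemma integrable_div_id (R : realType) (s : R -> R) (b : R) :
  (forall t : R, 1 < t -> (leb R).-integrable `]1, t[ (EFin \o s)) ->
  1 < b ->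
  (leb R).-integrable `[1, b] (EFin \o (fun x => s x / x)).
Proof.
move=> s_int b1.
have leb_itv := lebesgue_measurable_itv R.
have leb1 : leb R [set (1 : R)] = 0%E.
  exact: lebesgue_measure_set1.
have m1 : @measurable _ (lebesgueTypeR R) [set (1 : R)].
  by apply: borel_lebesgue_measurable; exact: measurable_set1.
have is1 : (leb R).-integrable `]1, b] (EFin \o s).
  apply: integrableS (s_int (b + 1) _) => //; last by lra.
  by apply: subset_itvl; rewrite bnd_simp; lra.
have i1 : (leb R).-integrable `]1, b] (EFin \o (fun x => s x / x)).
  have mV : @measurable_fun _ _ (lebesgueTypeR R) (measurableTypeR R) `]1, b]
     (fun x : R => x^-1).
    move=> _ B mB.
    apply: borel_lebesgue_measurable.
    have : measurable_fun (`]0, +oo[ : set R) (fun x : R => x^-1).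
      apply: open_continuous_measurable_fun => //.
      move=> x /set_mem; rewrite /= in_itv/= andbT => x0.
      by apply: inv_continuous; rewrite gt_eqF.
    move=> mV; apply: (measurable_funS _ _ mV) => //.
    by move=> x /=; rewrite !in_itv/= andbT => /andP[+ _]; exact: lt_trans.
  apply: (integrableMl _ is1 mV) => //.
  exists 1; split => // M M1 x /=; rewrite in_itv/= => /andP[x1 _].
  rewrite ger0_norm ?invr_ge0; last by lra.
  by apply: (le_trans _ (ltW M1)); rewrite invf_le1; lra.
(* The point 1 is a null set; it remains to integrate over ]1, b]. *)
apply/(negligible_integrable m1) => //.
- have -> : `[1, b]%classic = [set (1 : R)] `|` `]1, b].
    by apply/esym/setU1itv; rewrite bnd_simp ltW.
  apply/measurable_funU => //; split; first exact: measurable_fun_set1.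
  exact: measurable_int i1.
- apply: integrableS i1 => //; first exact: measurableD.
  move=> x [/=]; rewrite !in_itv/= => /andP[x1 ->] /eqP x_neq1.
  by rewrite lt_neqAle eq_sym x_neq1 x1.
Qed.

Lemma integrable_div_id_itv (R : realType) (s : R -> R) (a b : R) :
  (forall t : R, 1 < t -> (leb R).-integrable `]1, t[ (EFin \o s)) ->
  1 < a -> a < b -> (leb R).-integrable `]a, b] (EFin \o (fun x => s x / x)).
Proof.
move=> s_int a1 ab.
have leb_itv := lebesgue_measurable_itv R.
apply: integrableS (integrable_div_id R s b s_int _) => //; last by lra.
by move=> x /=; rewrite !in_itv/= => /andP[ax ->]; rewrite andbT; lra.
Qed.

Lemma integral_cst_div (R : realType) (c a b : R) : 1 < a -> a < b ->
  (leb R).-integrable `]a, b] (EFin \o (fun x => c / x)) /\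
  \int[leb R]_(x in `]a, b]) (c / x) = c * (ln b - ln a).
Proof.
move=> a1 ab.
have leb_itv := lebesgue_measurable_itv R.
have ic (k : R) : (leb R).-integrable `]a, b] (EFin \o (fun x => k / x)).
  apply: (integrable_div_id_itv R (cst k)) => // t t1.
  apply: measurable_bounded_integrable => //.
    suff : (lebesgue_measure (`]1%R, t[%classic : set R) < +oo)%E by [].
    by rewrite lebesgue_measure_itv/= lte_fin t1 -EFinB ltry.
  by exists `|k|; split => // M /ltW kM x _ /=; exact: kM.
split; first exact: ic.
rewrite RintegralZl//; last first.
  apply: eq_integrable (ic 1) => //.
  by move=> x _; rewrite /= mul1r.
by rewrite Rintegral_inv_ln//; lra.
Qed.

(** On the logarithmic scale [ln t * log_mean s t] is a primitive of [s]. *)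
Lemma log_mean_increment (R : realType) (s : R -> R) (a b : R) :
  (forall t : R, 1 < t -> (leb R).-integrable `]1, t[ (EFin \o s)) ->
  1 < a -> a < b ->
  ln b * log_mean s b - ln a * log_mean s a =
  \int[leb R]_(x in `]a, b]) (s x / x).
Proof.
move=> s_int a1 ab.
have b1 : 1 < b by lra.
have leb_itv := lebesgue_measurable_itv R.
rewrite /log_mean !mulVKf ?gt_eqF ?ln_gt0//.
have E : `[1, b]%classic = `[1, a]%classic `|` `]a, b].
  by rewrite -itv_bndbnd_setU// bnd_simp ltW.
rewrite E Rintegral_setU//.
- by rewrite addrC addKr.
- by rewrite -E; exact: integrable_div_id.
- apply/disj_setPS => y [/=]; rewrite 2!in_itv/= => /andP[_ yx] /andP[].
  by rewrite ltNge yx.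
Qed.

Lemma log_mean_increment_ge (R : realType) (s : R -> R) (a b c : R) :
  (forall t : R, 1 < t -> (leb R).-integrable `]1, t[ (EFin \o s)) ->
  1 < a -> a < b -> (forall x, a < x <= b -> c <= s x) ->
  c * (ln b - ln a) <= ln b * log_mean s b - ln a * log_mean s a.
Proof.
move=> s_int a1 ab cs; rewrite log_mean_increment//.
have [ic <-] := integral_cst_div R c a b a1 ab.
apply: le_Rintegral => //.
- exact: lebesgue_measurable_itv.
- exact: integrable_div_id_itv.
- move=> x /=; rewrite in_itv/= => xab.
  by rewrite ler_wpM2r ?cs// invr_ge0; lra.
Qed.

Lemma log_mean_increment_le (R : realType) (s : R -> R) (a b c : R) :
  (forall t : R, 1 < t -> (leb R).-integrable `]1, t[ (EFin \o s)) ->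
  1 < a -> a < b -> (forall x, a < x <= b -> s x <= c) ->
  ln b * log_mean s b - ln a * log_mean s a <= c * (ln b - ln a).
Proof.
move=> s_int a1 ab cs; rewrite log_mean_increment//.
have [ic <-] := integral_cst_div R c a b a1 ab.
apply: le_Rintegral => //.
- exact: lebesgue_measurable_itv.
- exact: integrable_div_id_itv.
- move=> x /=; rewrite in_itv/= => xab.
  by rewrite ler_wpM2r ?cs// invr_ge0; lra.
Qed.

(** * Statistical limits *)

(** A statistical limit is almost attained in every dyadic interval far enough
    to the right. *)
Lemma statistical_limit_near (R : realType) (g : R -> R) (l d : R) :
  is_statistical_limit 1 g l -> 0 < d ->
  \forall y \near +oo, exists x, [/\ y < x, x < 2 * y & `|g x - l| <= d].
Proof.
move=> [_ /(_ d)/[apply] cvg0].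
(* At the right end 2 y the exceptional set fills less than half of ]1, 2 y[. *)
have /cvg0 : nbhs (0%E : \bar R) [set z | (z < (2^-1)%:E)%E].
  apply: open_nbhs_nbhs; split; first exact: open_ereal_lt_ereal.
  by rewrite /= lte_fin invr_gt0.
move=> [M [_ hM]].
exists (`|M| + 1); split => // y My.
have M0 := ler_norm M; have M1 := normr_ge0 M.
have /hM : M < 2 * y by lra.
apply: contraPP => /forallNP no_x /=.
apply/negP; rewrite -leNgt.
(* Otherwise ]y, 2 y[, of length y > (2 y - 1) / 2, is exceptional. *)
have sub : (`]y, 2 * y[%classic : set R) `<=`
    [set x | 1 < x < 2 * y /\ d < `|g x - l|].
  move=> x /=; rewrite in_itv/= => /andP[yx x2y]; split; first by lra.
  by rewrite ltNge; apply/negP => xd; apply: (no_x x).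
(* [leb R] is an outer measure, monotone on all sets. *)
have : (leb R (`]y, (2 * y)%R[)%classic <=
        leb R [set x | (1 < x < 2 * y)%R /\ (d < `|g x - l|)%R])%E.
  exact: le_outer_measure.
have -> : leb R `]y, 2 * y[ = y%:E.
  transitivity (lebesgue_measure (`]y, 2 * y[%classic : set R)) => //.
  rewrite lebesgue_measure_itv/= lte_fin ifT; last by lra.
  by rewrite -EFinB; congr (_%:E); lra.
move=> yle.
apply: (@le_trans _ _ (((2 * y - 1)^-1)%:E * y%:E)%E).
  rewrite -EFinM lee_fin mulrC ler_pdivlMr; lra.
by rewrite lee_pmul2l// ?lte_fin ?invr_gt0; lra.
Qed.

(** The form in which the statistical limit is used: far enough to the right,
    every block ]p, p ^ lambda[ contains points [a < b] such that, when [g] is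
    [log_mean s], the mean of [s] over ]a, b] with respect to dx / x is within
    [e] of [l].  The point [a] is taken in ]p, 2 p[ and [b] in
    ]p ^ lambda / 2, p ^ lambda[. *)
Lemma statistical_limit_log_block (R : realType) (g : R -> R)
    (l lambda e : R) :
  is_statistical_limit 1 g l -> 1 < lambda -> 0 < e ->
  \forall p \near +oo, exists a b, [/\ p < a, a < b, b < p `^ lambda &
    `|ln b * g b - ln a * g a - l * (ln b - ln a)| <= e * (ln b - ln a)].
Proof.
move=> g_stat lambda1 e0.
(* The value of d makes d (ln a + ln b) <= e (ln b - ln a): the sum is at
   most 2 lambda ln p, the difference at least (lambda - 1) / 2 * ln p. *)
pose d := e * (lambda - 1) / (4 * lambda).
have d0 : 0 < d by rewrite divr_gt0 ?mulr_gt0; lra.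
have [M [_ hM]] := statistical_limit_near R g l d g_stat d0.
(* Beyond exp K the loss 2 ln 2 is at most (lambda - 1) / 2 * ln p. *)
pose K := 4 * ln 2 / (lambda - 1) : R.
exists (2 * `|M| + 1 + expR K); split; first exact: num_real.
move=> p Np.
have M0 := ler_norm M; have M1 := normr_ge0 M; have K0 := expR_gt0 K.
have p1 : 1 < p by lra.
have Kp : K < ln p by rewrite -(expRK K) ltr_ln ?posrE; lra.
have ln2 : 0 < ln (2 : R) by rewrite ln_gt0; lra.
have Ku : 4 * ln 2 < (lambda - 1) * ln p.
  by move: Kp; rewrite /K ltr_pdivrMr; lra.
have pq0 : 0 < p `^ lambda by rewrite powR_gt0; lra.
have u0 : 0 < ln p by rewrite ln_gt0.
have pq : p < p `^ lambda.
  by rewrite -ltr_ln ?posrE; [rewrite ln_powR; nra | lra | lra].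
have /hM[a [pa ap ga]] : M < p by lra.
have /hM[b [qb bq gb]] : M < p `^ lambda / 2 by lra.
have lna : ln p < ln a by rewrite ltr_ln ?posrE; lra.
have lna2 : ln a < ln 2 + ln p by rewrite -lnM ?ltr_ln ?posrE; lra.
have lnb : ln b < lambda * ln p by rewrite -ln_powR ltr_ln ?posrE; lra.
have lnb2 : lambda * ln p - ln 2 < ln b.
  by rewrite -ln_powR -ln_div ?ltr_ln ?posrE; lra.
have lnab : ln a < ln b by lra.
exists a, b; split => //; [|lra|].
  by move: lnab; rewrite ltr_ln ?posrE; lra.
have -> : ln b * g b - ln a * g a - l * (ln b - ln a) =
    ln b * (g b - l) - ln a * (g a - l) by ring.
apply: (le_trans (ler_normB _ _)); rewrite !normrM.
rewrite (gtr0_norm (_ : 0 < ln b)) ?(gtr0_norm (_ : 0 < ln a)); [|lra|lra].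
apply: (@le_trans _ _ (d * (ln b + ln a))); first by nra.
have -> : d * (ln b + ln a) =
    e * ((lambda - 1) * (ln b + ln a) / (4 * lambda)) by rewrite /d; ring.
rewrite ler_pM2l// ler_pdivrMr; last by lra.
have : 0 <= (lambda - 1) * (lambda * ln p - ln b) by rewrite mulr_ge0; lra.
have : 0 <= (lambda - 1) * (lambda * ln p - ln a) by rewrite mulr_ge0; lra.
have : 0 <= lambda * ((lambda - 1) * ln p - 4 * ln 2) by rewrite mulr_ge0; lra.
have : 0 <= lambda * (ln b - ln a - (lambda - 1) * ln p + 2 * ln 2).
  by rewrite mulr_ge0; lra.
lra.
Qed.

(** * The Tauberian theorem *)

Lemma slowly_decreasing_log_near (R : realType) (s : R -> R) (e : R) :
  slowly_decreasing_log s -> 0 < e ->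
  exists2 lambda : R, 1 < lambda &
    \forall x \near +oo, forall t, x < t -> t <= x `^ lambda -> - e <= s t - s x.
Proof.
move=> [m cvgm m0] e0.
have /cvgm : nbhs m [set y | ((- e)%:E < y)%E].
  apply: open_nbhs_nbhs; split; first exact: open_ereal_gt_ereal.
  by apply: lt_le_trans m0; rewrite lte_fin oppr_lt0.
move=> near_lambda.
have [lambda [lambda1 /=]] :=
  filter_ex (filterI (nbhs_right_gt (1 : R)) near_lambda).
rewrite limf_einfE => /ereal_sup_gt[_ [V nV <-] Ve].
exists lambda => //; apply: filterS nV => x Vx t xt tx.
rewrite -lee_fin; apply/ltW/(lt_le_trans Ve).
apply: (@le_trans _ _ (ereal_inf [set (s t - s x)%:E | t in `]x, x `^ lambda]])).
  by apply: ereal_inf_lbound; exists x.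
by apply: ereal_inf_lbound; exists t => //=; rewrite in_itv/= xt.
Qed.

(* s is a function on [1, +oo[: its values on ]-oo, 1[ are never used. *)
Theorem theorem3 (R : realType) (s : R -> R) (l : R)
  (s_int : forall t : R, 1 < t ->
     (@completed_lebesgue_measure R).-integrable `]1, t[ (EFin \o s))
  (s_slow : slowly_decreasing_log s)
  (s_stat : is_statistical_limit 1 (log_mean s) l) :
  s x @[x --> +oo] --> l.
Proof.
apply/cvgrPdist_le => e e0.
have e2 : 0 < e / 2 by lra.
have [lambda lambda1 s_dec] := slowly_decreasing_log_near R s _ s_slow e2.
have blocks := statistical_limit_log_block R _ l lambda _ s_stat lambda1 e2.
have [M [_ hM]] := filterI s_dec blocks.
pose N := `|M| + 1.
have M0 := ler_norm M; have M1 := normr_ge0 M.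
have N1 : 1 <= N by rewrite /N; lra.
have NM p : N < p -> M < p by rewrite /N; lra.
exists (N `^ lambda); split; first exact: num_real.
move=> x Nx.
have x0 : 0 < x by apply: le_lt_trans Nx; exact: powR_ge0.
have NNlambda : N <= N `^ lambda by rewrite le1r_powR//; lra.
have xN : N < x by exact: le_lt_trans Nx.
rewrite /= distrC ler_distl; apply/andP; split.
(* Lower bound: the block ends at x, and s <= s x + e / 2 on it. *)
- pose p := x `^ lambda^-1.
  have p_lambda : p `^ lambda = x.
    by rewrite /p -powRrM mulVf ?powRr1; lra.
  have pN : N < p.
    rewrite -ltr_ln ?posrE ?powR_gt0//; last by lra.
    rewrite ln_powR mulrC ltr_pdivlMr; last by lra.
    by rewrite mulrC -ln_powR ltr_ln ?posrE ?powR_gt0//; lra.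
  have [_ [a [b [pa ab]]]] := hM p (NM p pN).
  rewrite p_lambda ler_distl => bx /andP[inc _].
  have sle t : a < t <= b -> s t <= s x + e / 2.
    move=> /andP[at_ tb].
    have Mt : M < t by apply: NM; lra.
    have [/(_ x) dec _] := hM t Mt.
    have : x <= t `^ lambda.
      by rewrite -p_lambda ge0_ler_powR ?nnegrE; lra.
    by move=> /dec; lra.
  have a1 : 1 < a by lra.
  have := log_mean_increment_le R s a b _ s_int a1 ab sle.
  have : ln a < ln b by rewrite ltr_ln ?posrE; lra.
  move=> ? ?; suff : l - e / 2 <= s x + e / 2 by lra.
  rewrite -(@ler_pM2r _ (ln b - ln a)); lra.
(* Upper bound: the block starts at x, and s >= s x - e / 2 on it. *)
- have [dec [a [b [xa ab blambda]]]] := hM x (NM x xN).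
  rewrite ler_distl => /andP[_ inc].
  have sge t : a < t <= b -> s x - e / 2 <= s t.
    by move=> /andP[at_ tb]; have := dec t; lra.
  have a1 : 1 < a by lra.
  have := log_mean_increment_ge R s a b _ s_int a1 ab sge.
  have : ln a < ln b by rewrite ltr_ln ?posrE; lra.
  move=> ? ?; suff : s x - e / 2 <= l + e / 2 by lra.
  rewrite -(@ler_pM2r _ (ln b - ln a)); lra.
Qed.
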